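(* Let $p,q\in\mathbb{D}=\{z\in\mathbb{C}:|z|<1\}$. Then there exists a unique conic $\mathcal{C}$ with foci $p,q$ which is $3$-Poncelet inscribed in the unit circle $\mathbb{T}=\{z\in\mathbb{C}:|z|=1\}$. Moreover, $\mathcal{C}$ is an ellipse, namely the Blaschke ellipse with major axis of length $|1-\bar p q|$, i.e. $\{w\in\mathbb{C}:\ |w-p|+|w-q|=|1-\bar p q|\}$.
   Context: The plane is identified with $\mathbb{C}$. A conic with foci $p,q$ means a non-degenerate ellipse or hyperbola with foci $p$ and $q$ (a circle centred at $p$ if $p=q$). A conic $\mathcal{C}$ is $3$-Poncelet inscribed in $\mathbb{T}$ if there is a triangle inscribed in $\mathbb{T}$ (vertices on $\mathbb{T}$) and circumscribed about $\mathcal{C}$ (the lines containing the sides are tangent to $\mathcal{C}$; the points of tangency need not lie on the sides, and $\mathcal{C}$ need not lie inside $\mathbb{T}$). As usual for Poncelet's theorem this is understood in the complexified projective plane: consecutive vertices are the two intersections of a side with $\mathbb{T}$, and consecutive sides are the two tangents from a vertex to $\mathcal{C}$, both counted with multiplicity; the trivial polygon sitting at a point of tangency of the two conics is not counted. The Blaschke ellipse with foci $p,q$ (degree 3) is the ellipse tangent, for every $\lambda\in\mathbb{T}$, to the lines joining the three distinct solutions of $B(z)=\lambda$, where $B(z)=z\,\frac{p-z}{1-\bar p z}\,\frac{q-z}{1-\bar q z}$ is the Blaschke product with zeros $0,p,q$; it is given by $|w-p|+|w-q|=|1-\bar pq|$. *)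

(* Defs.v *)
From HB Require Import structures.
From mathcomp Require Import all_boot all_order all_algebra.
From mathcomp Require Import mathcomp_extra boolp classical_sets reals complex.

Set Implicit Arguments.
Unset Strict Implicit.
Unset Printing Implicit Defensive.

Import Order.TTheory GRing.Theory Num.Theory.

Local Open Scope classical_set_scope.
Local Open Scope ring_scope.

(* On R[i] the norm is R[i]-valued and x < y implies that y - x is real. *)

(* Here d is the length of the major axis, so p = q gives the circle centred
   at p with diameter d. *)
Definition ellipse (R : realType) (p q d : R[i]) : set R[i] :=
  [set w | `|w - p| + `|w - q| = d].

Definition hyperbola (R : realType) (p q d : R[i]) : set R[i] :=
  [set w | `| `|w - p| - `|w - q| | = d].

Definition ellipse_with_foci (R : realType) (p q : R[i]) (C : set R[i]) : Prop :=
  exists2 d : R[i], `|p - q| < d & C = ellipse p q d.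

Definition hyperbola_with_foci (R : realType) (p q : R[i]) (C : set R[i]) : Prop :=
  exists2 d : R[i], 0 < d < `|p - q| & C = hyperbola p q d.

Definition conic_with_foci (R : realType) (p q : R[i]) (C : set R[i]) : Prop :=
  ellipse_with_foci p q C \/ hyperbola_with_foci p q C.

(* The complex projective plane: a point is represented by a nonzero row vector
   x, a line by a nonzero row vector l (the line x *m l^T = 0), equality of
   points or of lines is equality of row spaces, and a conic is represented by
   a symmetric matrix A (the conic x *m A *m x^T = 0). *)

(* x + i y |-> (x : y : 1) *)
Definition plane_point (R : realType) (w : R[i]) : 'rV[R[i]]_3 :=
  \row_i [:: (complex.Re w)%:C%C; (complex.Im w)%:C%C; 1]`_i.

Definition on_line (R : realType) (l x : 'rV[R[i]]_3) : Prop := x *m l^T = 0.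

Definition on_conic (R : realType) (A : 'M[R[i]]_3) (x : 'rV[R[i]]_3) : Prop :=
  x *m A *m x^T = 0.

Definition complexify (R : realType) (A : 'M[R]_3) : 'M[R[i]]_3 :=
  map_mx (real_complex R) A.

Definition conic_equation (R : realType) (A : 'M[R]_3) (C : set R[i]) : Prop :=
  [/\ A^T = A, \det A != 0 &
      C = [set w | on_conic (complexify A) (plane_point w)]].

Definition tangent_at (R : realType) (A : 'M[R[i]]_3) (x l : 'rV[R[i]]_3) : Prop :=
  on_conic A x /\ (l == x *m A)%MS.

Definition tangent (R : realType) (A : 'M[R[i]]_3) (l : 'rV[R[i]]_3) : Prop :=
  exists2 x : 'rV[R[i]]_3, x != 0 & tangent_at A x l.

(* x and y are the two intersections of l with the conic A, counted with
   multiplicity. *)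
Definition intersections (R : realType) (A : 'M[R[i]]_3)
    (l x y : 'rV[R[i]]_3) : Prop :=
  [/\ on_conic A x /\ on_line l x, on_conic A y /\ on_line l y &
      (x == y)%MS -> tangent_at A x l].

(* l and m are the two tangents from x to the conic A, counted with
   multiplicity; they coincide exactly when x lies on A. *)
Definition tangents_from (R : realType) (A : 'M[R[i]]_3)
    (x l m : 'rV[R[i]]_3) : Prop :=
  [/\ tangent A l /\ on_line l x, tangent A m /\ on_line m x &
      (l == m)%MS -> tangent_at A x l].

(* The vertices are v 0, v 1, v 2 and the side l i joins v i to v (i + 1), with
   indices modulo 3. *)
Definition poncelet_triangle (R : realType) (K A : 'M[R[i]]_3)
    (v l : 'I_3 -> 'rV[R[i]]_3) : Prop :=
  forall i : 'I_3,
    [/\ v i != 0, l i != 0,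
        intersections K (l i) (v i) (v (ordS i)) &
        tangents_from A (v (ordS i)) (l i) (l (ordS i))].

Definition trivial_polygon (R : realType) (K A : 'M[R[i]]_3)
    (v l : 'I_3 -> 'rV[R[i]]_3) : Prop :=
  exists x t : 'rV[R[i]]_3,
    [/\ tangent_at K x t, tangent_at A x t &
        forall i, (v i == x)%MS /\ (l i == t)%MS].

Definition unit_circle_mx (R : realType) : 'M[R]_3 :=
  diag_mx (\row_i [:: 1; 1; -1]`_i).

Lemma unit_circle_equation (R : realType) :
  conic_equation (unit_circle_mx R) [set w : R[i] | `|w| = 1].
Proof.
split; first exact: tr_diag_mx.
  by rewrite det_diag !big_ord_recl big_ord0 !mxE /= mulr1 !mul1r oppr_eq0 oner_eq0.
rewrite predeqE => -[x y]; rewrite /on_conic /complexify /=.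
have -> : plane_point (x +i* y)%C *m map_mx (real_complex R) (unit_circle_mx R) *m
    (plane_point (x +i* y)%C)^T = ((x ^+ 2 + y ^+ 2 - 1)%:C%C)%:M.
  apply/rowP => j; rewrite !ord1 !mxE !big_ord_recl big_ord0.
  rewrite !mxE !big_ord_recl !big_ord0 !mxE /=.
  rewrite !mulr0n !mulr1n !rmorph0 !rmorphD !rmorphN !rmorph1 !rmorphXn /=.
  by rewrite !mulr0 !addr0 !add0r !mulr1 mul1r !addrA -!expr2.
have -> : (`|(x +i* y)%C| = 1) = (x ^+ 2 + y ^+ 2 - 1 = 0).
  rewrite propeqE normc_def /=.
  have -> : (1 : R[i]) = (1 : R)%:C%C by [].
  have ge0 : 0 <= x ^+ 2 + y ^+ 2 by rewrite addr_ge0 ?sqr_ge0.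
  split=> [/complexI /(congr1 (fun z => z ^+ 2))|/eqP].
    by rewrite sqr_sqrtr // expr1n => ->; rewrite subrr.
  by rewrite subr_eq0 => /eqP ->; rewrite sqrtr1.
split=> [->|/matrixP/(_ 0 0)]; first by apply/rowP => j; rewrite !mxE mul0rn.
by rewrite !mxE /= mulr1n => /complexI.
Qed.

Definition poncelet3_inscribed (R : realType) (C : set R[i]) : Prop :=
  exists2 A : 'M[R]_3, conic_equation A C &
    exists v l : 'I_3 -> 'rV[R[i]]_3,
      poncelet_triangle (complexify (unit_circle_mx R)) (complexify A) v l /\
      ~ trivial_polygon (complexify (unit_circle_mx R)) (complexify A) v l.

Definition blaschke (R : realType) (p q z : R[i]) : R[i] :=
  z * ((p - z) / (1 - p^* * z)) * ((q - z) / (1 - q^* * z)).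

Definition blaschke_ellipse (R : realType) (p q : R[i]) (C : set R[i]) : Prop :=
  ellipse_with_foci p q C /\
  exists2 A : 'M[R]_3, conic_equation A C &
    forall lambda z1 z2 : R[i], `|lambda| = 1 ->
      blaschke p q z1 = lambda -> blaschke p q z2 = lambda -> z1 != z2 ->
      forall l : 'rV[R[i]]_3, l != 0 ->
        on_line l (plane_point z1) -> on_line l (plane_point z2) ->
        tangent (complexify A) l.

(* Main.v *)
Require Import Defs.
From HB Require Import structures.
From mathcomp Require Import all_boot all_order all_algebra separable.
From mathcomp Require Import mathcomp_extra boolp classical_sets reals complex.
From mathcomp Require Import ring lra.

Set Implicit Arguments.
Unset Strict Implicit.
Unset Printing Implicit Defensive.

Import Order.TTheory GRing.Theory Num.Theory.

Local Open Scope classical_set_scope.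
Local Open Scope ring_scope.

(** Parametrise the complexified circle by z = s/r in the projective line. A
    conic with foci p, q and major axis sqrt t is, dually, the set of lines with
    4 l(p) l(q) = k (l_1^2 + l_2^2), where k = t - |p - q|^2 (negative for a
    hyperbola). The chord with end parameters z, w is therefore tangent to it iff
      T_k(z, w) := (p + p^* z w - z - w) (q + q^* z w - z - w) - k z w = 0.
    For k0 = (1 - |p|^2) (1 - |q|^2), that is, t = |1 - p^* q|^2, the form T_k is
    the Bezoutian (N(z) D(w) - N(w) D(z)) / (z - w) of the Blaschke product
    B = N / D, so that the chord joining two solutions of B(z) = L is tangent.
    Since B(z) = L has three distinct solutions when |L| = 1, these form a
    Poncelet triangle. Conversely let z1, z2, z3 be the vertices of a Poncelet
    triangle for k. The polynomial T_k(zi, w) has the two other vertices as its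
    roots in w, which gives N(zi) = mu_i e3 and D(zi) = mu_i for the product e3
    of the vertices, and shows that (k - k0) zi (zi, 1) is mu_i times a vector
    independent of i. If k <> k0 this makes the three vertices coincide. *)

(** * Binary quadratic forms and the tangency form *)

Section BinaryQuadratic.
Context {F : fieldType}.
Implicit Types (a b c : F) (z w : F * F).

(* A pair (s, r) <> 0 stands for the point s/r of the projective line. *)
Definition wedge z w := z.1 * w.2 - z.2 * w.1.

Lemma wedgexx z : wedge z z = 0.
Proof. by rewrite /wedge mulrC subrr. Qed.

Lemma wedgeN z w : wedge w z = - wedge z w.
Proof. by rewrite /wedge; ring. Qed.

Lemma wedge_eq0P z w : z != 0 -> w != 0 -> wedge z w = 0 ->
  exists2 c, c != 0 & w = (c * z.1, c * z.2).
Proof.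
case: z w => [s r] [s' r'] nz nw /subr0_eq /= zw.
have [c [es er]] : exists c, s' = c * s /\ r' = c * r.
  have [s0|ns] := eqVneq s 0.
    have nr : r != 0 by move: nz; rewrite s0 xpair_eqE eqxx.
    exists (r' / r); split; last by rewrite divfK.
    by apply: (mulfI nr); rewrite -zw; field.
  exists (s' / s); split; first by rewrite divfK.
  by apply: (mulfI ns); rewrite zw; field.
exists c; last by rewrite es er.
by apply: contraNneq nw => c0; rewrite es er c0 !mul0r.
Qed.

Lemma wedge_neq0_exists z w : z != 0 -> w != 0 ->
  exists2 u, wedge z u != 0 & wedge w u != 0.
Proof.
move=> nz nw; have [zw|nzw] := eqVneq (wedge z w) 0; last first.
  exists (z.1 + w.1, z.2 + w.2).
    by rewrite (_ : wedge z _ = wedge z w) // /wedge /=; ring.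
  by rewrite (_ : wedge w _ = - wedge z w) ?oppr_eq0 // /wedge /=; ring.
have [u zu] : exists u, wedge z u != 0.
  have [z10|nz1] := eqVneq z.1 0; last first.
    by exists (0, 1); rewrite /wedge /= mulr1 mulr0 subr0.
  exists (1, 0); rewrite /wedge z10 mul0r sub0r mulr1 oppr_eq0.
  by apply: contraNneq nz => z20; rewrite [z]surjective_pairing z10 z20.
exists u => //; have [c nc ->] := wedge_eq0P nz nw zw.
by rewrite /wedge /= -!mulrA -mulrBr mulf_neq0.
Qed.

Definition binary_quadratic a b c w := a * w.1 ^+ 2 + b * (w.1 * w.2) + c * w.2 ^+ 2.

Lemma binary_quadratic_factor a b c w1 w2 : wedge w1 w2 != 0 ->
  binary_quadratic a b c w1 = 0 -> binary_quadratic a b c w2 = 0 ->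
  exists mu, forall w, binary_quadratic a b c w = mu * (wedge w1 w * wedge w2 w).
Proof.
case: w1 w2 => [s1 r1] [s2 r2]; rewrite /binary_quadratic /wedge /=.
move=> nw12 root1 root2.
pose polar := 2 * a * (s1 * s2) + b * (s1 * r2 + r1 * s2) + 2 * c * (r1 * r2).
exists (- (polar / (s1 * r2 - r1 * s2) ^+ 2)) => -[s r] /=.
(* Expand the form at (s, r) = x (s1, r1) + y (s2, r2). *)
pose x := (s * r2 - r * s2) / (s1 * r2 - r1 * s2).
pose y := (s1 * r - r1 * s) / (s1 * r2 - r1 * s2).
transitivity ((a * s1 ^+ 2 + b * (s1 * r1) + c * r1 ^+ 2) * x ^+ 2
  + (a * s2 ^+ 2 + b * (s2 * r2) + c * r2 ^+ 2) * y ^+ 2 + polar * (x * y)).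
  by rewrite /x /y /polar; field.
by rewrite root1 root2 /x /y; field.
Qed.

Lemma binary_quadratic_factor_double a b c w1 : w1 != 0 -> 2 != 0 :> F ->
  2 * a * w1.1 + b * w1.2 = 0 -> b * w1.1 + 2 * c * w1.2 = 0 ->
  exists mu, forall w, binary_quadratic a b c w = mu * wedge w1 w ^+ 2.
Proof.
case: w1 => [s r]; rewrite /binary_quadratic /wedge /= => nz two_neq0.
move=> /eqP; rewrite addr_eq0 => /eqP partial_s.
move=> /eqP; rewrite addrC addr_eq0 => /eqP partial_r.
have [r0|nr] := eqVneq r 0.
  have ns : s != 0 by move: nz; rewrite r0 xpair_eqE eqxx andbT.
  have a0 : a = 0.
    by apply: (mulfI two_neq0); apply: (mulIf ns); rewrite partial_s r0; ring.
  have b0 : b = 0.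
    by apply: (mulIf ns); rewrite mul0r -[LHS]opprK -partial_r r0; ring.
  by exists (c / s ^+ 2) => w; rewrite a0 b0 r0; field.
exists (a / r ^+ 2) => w.
have bE : b = - (2 * a * s) / r by rewrite partial_s; field.
have -> : c = a * s ^+ 2 / r ^+ 2.
  by apply: (mulfI two_neq0); apply: (mulIf nr); rewrite partial_r bE; field.
by rewrite bE; field.
Qed.

Lemma binary_quadratic_inj a b c a' b' c' :
  (forall w, binary_quadratic a b c w = binary_quadratic a' b' c' w) ->
  [/\ a = a', b = b' & c = c'].
Proof.
rewrite /binary_quadratic => h; have /= := (h (1, 0), h (0, 1), h (1, 1)).
rewrite !(expr0n, expr1n, mulr1, mulr0, mul0r, addr0, add0r) /= => -[[-> ->]].
by move=> /addIr/addrI ->.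
Qed.

End BinaryQuadratic.

Section TangentChords.
Context {F : fieldType}.
Variables (p p' q q' : F).
Implicit Types (k : F) (z w : F * F).

(* The value at the point p of the equation of the chord from z to w; here p' and
   q' stand for the conjugates of p and q. *)
Definition chord_value (p p' : F) z w :=
  p * (z.2 * w.2) + p' * (z.1 * w.1) - (z.1 * w.2 + w.1 * z.2).

Definition tangency k z w :=
  chord_value p p' z w * chord_value q q' z w - k * (z.1 * z.2 * (w.1 * w.2)).

Definition tangency_polar k z w1 w2 :=
  chord_value p p' z w1 * chord_value q q' z w2
  + chord_value p p' z w2 * chord_value q q' z w1
  - k * (z.1 * z.2 * (w1.1 * w2.2 + w2.1 * w1.2)).

Lemma tangency_polarxx k z w : tangency_polar k z w w = 2 * tangency k z w.
Proof. by rewrite /tangency_polar /tangency; ring. Qed.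

Definition tangency_lead z := (z.2 - p' * z.1) * (z.2 - q' * z.1).

Definition tangency_mid k z :=
  - ((p * z.2 - z.1) * (z.2 - q' * z.1) + (q * z.2 - z.1) * (z.2 - p' * z.1)
     + k * (z.1 * z.2)).

Definition tangency_const z := (p * z.2 - z.1) * (q * z.2 - z.1).

Lemma tangencyE k z w : tangency k z w =
  binary_quadratic (tangency_lead z) (tangency_mid k z) (tangency_const z) w.
Proof.
rewrite /tangency /chord_value /binary_quadratic.
by rewrite /tangency_lead /tangency_mid /tangency_const; ring.
Qed.

(* The two tangents from z meet the circle again at w1 and w2, with multiplicity. *)
Definition neighbours k z w1 w2 :=
  exists mu, forall w, tangency k z w = mu * (wedge w1 w * wedge w2 w).

Lemma neighboursC k z w1 w2 : neighbours k z w1 w2 -> neighbours k z w2 w1.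
Proof. by case=> mu factor; exists mu => w; rewrite factor [_ * wedge w2 w]mulrC. Qed.

Lemma neighbours_distinct k z w1 w2 : wedge w1 w2 != 0 ->
  tangency k z w1 = 0 -> tangency k z w2 = 0 -> neighbours k z w1 w2.
Proof.
rewrite !tangencyE => nw12 root1 root2.
have [mu factor] := binary_quadratic_factor nw12 root1 root2.
by exists mu => w; rewrite tangencyE factor.
Qed.

Lemma neighbours_double k z w1 w2 : 2 != 0 :> F ->
  w1 != 0 -> w2 != 0 -> wedge w1 w2 = 0 ->
  (forall w, tangency_polar k z w w1 = 0) -> neighbours k z w1 w2.
Proof.
move=> two_neq0 nw1 nw2 /(wedge_eq0P nw1 nw2)[c nc ->] polar.
have lin w : 2 * tangency_lead z * (w.1 * w1.1)
    + tangency_mid k z * (w.1 * w1.2 + w1.1 * w.2)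
    + 2 * tangency_const z * (w.2 * w1.2) = 0.
  rewrite -(polar w) /tangency_polar /chord_value.
  by rewrite /tangency_lead /tangency_mid /tangency_const; ring.
have [||mu factor] := @binary_quadratic_factor_double _ (tangency_lead z)
    (tangency_mid k z) (tangency_const z) w1 nw1 two_neq0.
- by rewrite -(lin (1, 0)) /=; ring.
- by rewrite -(lin (0, 1)) /=; ring.
by exists (mu / c) => w; rewrite tangencyE factor /wedge /=; field.
Qed.

Lemma neighbours_coef k z w1 w2 : neighbours k z w1 w2 -> exists mu,
  [/\ tangency_lead z = mu * (w1.2 * w2.2),
      tangency_mid k z = - (mu * (w1.1 * w2.2 + w1.2 * w2.1)) &
      tangency_const z = mu * (w1.1 * w2.1)].
Proof.
case=> mu factor; exists mu; apply: binary_quadratic_inj => w.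
by rewrite -tangencyE factor /binary_quadratic /wedge; ring.
Qed.

Definition blaschke_num z := z.1 * tangency_const z.

Definition blaschke_den z := z.2 * tangency_lead z.

Definition in_blaschke_fiber L z := blaschke_num z = L * blaschke_den z.

Definition focal_constant := (1 - p * p') * (1 - q * q').

Lemma blaschke_bezoutian z w :
  blaschke_num z * blaschke_den w - blaschke_num w * blaschke_den z
  = wedge z w * tangency focal_constant z w.
Proof.
rewrite /blaschke_num /blaschke_den /tangency_lead /tangency_const.
by rewrite /tangency /chord_value /wedge /focal_constant; ring.
Qed.

Lemma tangency_blaschke_fiber L z w : wedge z w != 0 ->
  in_blaschke_fiber L z -> in_blaschke_fiber L w -> tangency focal_constant z w = 0.
Proof.
move=> nzw fiber_z fiber_w; apply: (mulfI nzw).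
by rewrite -blaschke_bezoutian fiber_z fiber_w; ring.
Qed.

(* Let e1, e2, e3 be the elementary symmetric functions of the parameters s/r of
   z1, z2, z3. The defects vanish iff e1 = p + q + p' q' e3 and
   e2 = p q + (p' + q') e3, that is, iff B - e3 has the zeros z1, z2, z3. *)
Definition e1_defect z1 z2 z3 :=
  z1.1 * z2.2 * z3.2 + z1.2 * z2.1 * z3.2 + z1.2 * z2.2 * z3.1
  - (p + q) * (z1.2 * z2.2 * z3.2) - p' * q' * (z1.1 * z2.1 * z3.1).

Definition e2_defect z1 z2 z3 :=
  z1.1 * z2.1 * z3.2 + z1.1 * z2.2 * z3.1 + z1.2 * z2.1 * z3.1
  - p * q * (z1.2 * z2.2 * z3.2) - (p' + q') * (z1.1 * z2.1 * z3.1).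

Lemma e1_defect_rot z1 z2 z3 : e1_defect z2 z3 z1 = e1_defect z1 z2 z3.
Proof. by rewrite /e1_defect; ring. Qed.

Lemma e2_defect_rot z1 z2 z3 : e2_defect z2 z3 z1 = e2_defect z1 z2 z3.
Proof. by rewrite /e2_defect; ring. Qed.

Lemma blaschke_num_eq0 z : z.1 * z.2 = 0 -> blaschke_num z = 0 -> z.1 = 0.
Proof.
move=> /eqP; rewrite mulf_eq0 => /orP[/eqP //|/eqP z20].
rewrite /blaschke_num /tangency_const z20 !mulr0 !sub0r mulrNN.
by move=> /eqP; rewrite !mulf_eq0 !orbb => /eqP.
Qed.

Lemma blaschke_den_eq0 z : z.1 * z.2 = 0 -> blaschke_den z = 0 -> z.2 = 0.
Proof.
move=> /eqP; rewrite mulf_eq0 => /orP[/eqP z10|/eqP //].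
rewrite /blaschke_den /tangency_lead z10 !mulr0 !subr0.
by move=> /eqP; rewrite !mulf_eq0 !orbb => /eqP.
Qed.

Lemma neighbours_blaschke k z1 z2 z3 : k != focal_constant -> z1 != 0 ->
  neighbours k z1 z2 z3 -> exists2 mu, mu != 0 &
  [/\ blaschke_num z1 = mu * (z1.1 * z2.1 * z3.1),
      blaschke_den z1 = mu * (z1.2 * z2.2 * z3.2),
      mu * e1_defect z1 z2 z3 = (k - focal_constant) * (z1.1 * z1.2) * z1.2 &
      mu * e2_defect z1 z2 z3 = (k - focal_constant) * (z1.1 * z1.2) * z1.1].
Proof.
rewrite -subr_eq0 => nk nz1 /neighbours_coef[mu [lead mid const]].
have num : blaschke_num z1 = mu * (z1.1 * z2.1 * z3.1).
  by rewrite /blaschke_num const; ring.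
have den : blaschke_den z1 = mu * (z1.2 * z2.2 * z3.2).
  by rewrite /blaschke_den lead; ring.
have e1E : mu * e1_defect z1 z2 z3 = (k - focal_constant) * (z1.1 * z1.2) * z1.2.
  transitivity (z1.1 * tangency_lead z1 - z1.2 * tangency_mid k z1
    - (p + q) * z1.2 * tangency_lead z1 - p' * q' * z1.1 * tangency_const z1).
    by rewrite lead mid const /e1_defect; ring.
  by rewrite /tangency_lead /tangency_mid /tangency_const /focal_constant; ring.
have e2E : mu * e2_defect z1 z2 z3 = (k - focal_constant) * (z1.1 * z1.2) * z1.1.
  transitivity (z1.2 * tangency_const z1 - z1.1 * tangency_mid k z1
    - p * q * z1.2 * tangency_lead z1 - (p' + q') * z1.1 * tangency_const z1).
    by rewrite lead mid const /e2_defect; ring.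
  by rewrite /tangency_lead /tangency_mid /tangency_const /focal_constant; ring.
exists mu => //; apply: contra_neq nz1 => mu0.
have prod0 : z1.1 * z1.2 = 0.
  move/eqP: e1E; rewrite mu0 mul0r eq_sym !mulf_eq0 (negPf nk) /=.
  by rewrite -orbA orbb => /orP[]/eqP ->; rewrite ?mul0r ?mulr0.
rewrite mu0 !mul0r in num den.
rewrite [z1]surjective_pairing.
by rewrite (blaschke_num_eq0 prod0 num) (blaschke_den_eq0 prod0 den).
Qed.

Lemma neighbours_wedge_eq0 k z1 z2 z3 : k != focal_constant ->
  z1 != 0 -> z2 != 0 -> neighbours k z1 z2 z3 -> neighbours k z2 z3 z1 ->
  wedge z1 z2 = 0.
Proof.
move=> nk nz1 nz2 /(neighbours_blaschke nk nz1)[mu1 nmu1 [_ _ e1_z1 e2_z1]].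
move=> /(neighbours_blaschke nk nz2)[mu2 nmu2 []].
rewrite e1_defect_rot e2_defect_rot => num2 den2 e1_z2 e2_z2.
have {}nk : k - focal_constant != 0 by rewrite subr_eq0.
have param_prod_eq0 z mu : z != 0 -> mu != 0 ->
    mu * e1_defect z1 z2 z3 = (k - focal_constant) * (z.1 * z.2) * z.2 ->
    mu * e2_defect z1 z2 z3 = (k - focal_constant) * (z.1 * z.2) * z.1 ->
    (z.1 * z.2 == 0) = (e1_defect z1 z2 z3 == 0) && (e2_defect z1 z2 z3 == 0).
  rewrite [z]surjective_pairing xpair_eqE /= => nz nmu e1E e2E.
  rewrite -(mulrI_eq0 (e1_defect _ _ _) (mulfI nmu)) e1E.
  rewrite -(mulrI_eq0 (e2_defect _ _ _) (mulfI nmu)) e2E.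
  rewrite -!mulrA !(mulrI_eq0 _ (mulfI nk)) !mulf_eq0.
  by case: eqP nz => //; case: eqP.
have [prod1|nprod1] := eqVneq (z1.1 * z1.2) 0.
  have /eqP prod2 : z2.1 * z2.2 == 0.
    rewrite (param_prod_eq0 _ _ nz2 nmu2) // -(param_prod_eq0 _ _ nz1 nmu1) //.
    by rewrite prod1.
  move/eqP: prod1; rewrite mulf_eq0 /wedge => /orP[]/eqP z10.
    by rewrite z10 (blaschke_num_eq0 prod2) ?num2 ?z10; ring.
  by rewrite z10 (blaschke_den_eq0 prod2) ?den2 ?z10; ring.
have nprod2 : z2.1 * z2.2 != 0.
  by rewrite (param_prod_eq0 _ _ nz2 nmu2) // -(param_prod_eq0 _ _ nz1 nmu1).
apply: (mulfI (mulf_neq0 (mulf_neq0 nk nprod1) (mulf_neq0 nk nprod2))).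
transitivity (mu1 * e2_defect z1 z2 z3 * (mu2 * e1_defect z1 z2 z3)
  - mu1 * e1_defect z1 z2 z3 * (mu2 * e2_defect z1 z2 z3)).
  by rewrite e1_z1 e2_z1 e1_z2 e2_z2 /wedge; ring.
by ring.
Qed.

End TangentChords.

(** * Coordinates and duality *)

Section Coordinates.
Context {K : comNzRingType}.
Implicit Types (a b c d e f : K).

Definition row3 a b c : 'rV[K]_3 := \row_j [:: a; b; c]`_j.

Definition sym3 a b c d e f : 'M[K]_3 :=
  \matrix_(i, j) (nth [::] [:: [:: a; b; c]; [:: b; d; e]; [:: c; e; f]] i)`_j.

Lemma row3P (v : 'rV[K]_3) : exists a b c, v = row3 a b c.
Proof.
exists (v 0 0), (v 0 1), (v 0 2); apply/rowP; case; case=> [|[|[|//]]] lt3;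
  rewrite mxE /=; congr (v _ _); exact/val_inj.
Qed.

Lemma row3_0 : row3 0 0 0 = 0.
Proof. by apply/rowP; case; case=> [|[|[|//]]] lt3; rewrite !mxE. Qed.

Lemma scale_row3 x a b c : x *: row3 a b c = row3 (x * a) (x * b) (x * c).
Proof. by apply/rowP; case; case=> [|[|[|//]]] lt3; rewrite !mxE. Qed.

Lemma sym3P (A : 'M[K]_3) : A^T = A -> exists a b c d e f, A = sym3 a b c d e f.
Proof.
move=> sA; have h i j : A i j = A j i by rewrite -{1}sA mxE.
exists (A 0 0), (A 0 1), (A 0 2), (A 1 1), (A 1 2), (A 2 2).
apply/matrixP; case; case=> [|[|[|//]]] lti; case; case=> [|[|[|//]]] ltj;
  rewrite mxE /=; solve [by congr (A _ _); apply/val_inj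
  | by rewrite h; congr (A _ _); apply/val_inj].
Qed.

Lemma tr_sym3 a b c d e f : (sym3 a b c d e f)^T = sym3 a b c d e f.
Proof.
by apply/matrixP; case; case=> [|[|[|//]]] lti; case; case=> [|[|[|//]]] ltj;
  rewrite !mxE.
Qed.

Lemma scale_sym3 x a b c d e f :
  x *: sym3 a b c d e f = sym3 (x * a) (x * b) (x * c) (x * d) (x * e) (x * f).
Proof.
by apply/matrixP; case; case=> [|[|[|//]]] lti; case; case=> [|[|[|//]]] ltj;
  rewrite !mxE.
Qed.

Lemma mul_row3_tr a b c a' b' c' :
  row3 a b c *m (row3 a' b' c')^T = (a * a' + b * b' + c * c')%:M.
Proof.
apply/rowP => j; rewrite !ord1 !mxE !big_ord_recl big_ord0 !mxE /= mulr1n.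
by ring.
Qed.

Lemma mul_row3_sym3 x y z a b c d e f :
  row3 x y z *m sym3 a b c d e f =
  row3 (x * a + y * b + z * c) (x * b + y * d + z * e) (x * c + y * e + z * f).
Proof.
apply/rowP; case; case=> [|[|[|//]]] lt3;
  rewrite !mxE !big_ord_recl big_ord0 !mxE /=; ring.
Qed.

Lemma scalar_mx11_eq0 a : (a%:M = 0 :> 'M_1) <-> a = 0.
Proof. by split=> [/matrixP/(_ 0 0)|->]; rewrite ?mxE ?mulr1n // raddf0. Qed.

End Coordinates.

Section RowSpaces.
Context {F : fieldType}.

Lemma eqmxb_refl m n (A : 'M[F]_(m, n)) : (A == A)%MS.
Proof. by rewrite submx_refl. Qed.

Lemma eqmxb_sym m1 m2 n (A : 'M[F]_(m1, n)) (B : 'M[F]_(m2, n)) :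
  (A == B)%MS = (B == A)%MS.
Proof. exact: andbC. Qed.

Lemma eqmxb_trans m1 m2 m3 n
    (B : 'M[F]_(m2, n)) (A : 'M[F]_(m1, n)) (D : 'M[F]_(m3, n)) :
  (A == B)%MS -> (B == D)%MS -> (A == D)%MS.
Proof. by move=> /eqmxP AB /eqmxP BD; exact/eqmxP/(eqmx_trans AB). Qed.

Lemma eqmx_rowP n (x y : 'rV[F]_n) :
  reflect (exists2 c, c != 0 & x = c *: y) (x == y)%MS.
Proof.
apply: (iffP idP) => [/andP[/sub_rVP[c ex] /sub_rVP[d ey]]|[c nc ->]]; last first.
  exact/eqmxP/eqmx_scale.
have [y0|ny] := eqVneq y 0; first by exists 1; rewrite ?oner_neq0 // ex y0 !scaler0.
by exists c => //; apply: contraNneq ny => c0; rewrite ey ex c0 scale0r scaler0.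
Qed.

Lemma projective_line_unique (x y l m : 'rV[F]_3) :
  x != 0 -> y != 0 -> ~~ (x == y)%MS -> l != 0 -> m != 0 ->
  x *m l^T = 0 -> y *m l^T = 0 -> x *m m^T = 0 -> y *m m^T = 0 -> (l == m)%MS.
Proof.
move=> nx ny nxy nl nm xl yl xm ym; pose S := (x + y)%MS.
have rS : (1 < \rank S)%N.
  rewrite ltnNge; apply: contra nxy => rS1.
  have eqS (v : 'rV_3) : v != 0 -> (v <= S)%MS -> (v == S)%MS.
    move=> nv vS; rewrite -(mxrank_leqif_eq vS) eqn_leq mxrankS //=.
    by rewrite rank_rV nv.
  apply: eqmxb_trans (eqS x nx (addsmxSl x y)) _.
  by rewrite eqmxb_sym eqS // addsmxSr.
have ker (v : 'rV_3) : x *m v^T = 0 -> y *m v^T = 0 -> (v <= kermx S^T)%MS.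
  move=> xv yv; apply/sub_kermxP; rewrite -[LHS]trmxK trmx_mul trmxK.
  apply/eqP; rewrite trmx_eq0 -submx0 addsmxMr addsmx_sub.
  by rewrite xv yv !sub0mx.
have eq_ker (v : 'rV_3) :
    v != 0 -> x *m v^T = 0 -> y *m v^T = 0 -> (v == kermx S^T)%MS.
  move=> nv xv yv; rewrite -(mxrank_leqif_eq (ker v xv yv)) eqn_leq mxrankS ?ker //=.
  by rewrite mxrank_ker mxrank_tr rank_rV nv leq_subLR addn1.
by apply: eqmxb_trans (eq_ker l nl xl yl) _; rewrite eqmxb_sym eq_ker.
Qed.

End RowSpaces.

Section Incidence.
Context {R : realType}.
Local Notation C := R[i].
Implicit Types (A D K : 'M[C]_3) (x l : 'rV[C]_3).

Lemma on_line_eqmx x x' l l' : (x == x')%MS -> (l == l')%MS ->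
  on_line l x -> on_line l' x'.
Proof.
rewrite /on_line => + + lx; rewrite eqmxb_sym => /eqmx_rowP[c _ ->].
rewrite eqmxb_sym => /eqmx_rowP[d _ ->].
by rewrite linearZ -scalemxAl /= -scalemxAr lx !scaler0.
Qed.

Lemma on_conic_eqmx A x x' : (x == x')%MS -> on_conic A x -> on_conic A x'.
Proof.
rewrite /on_conic eqmxb_sym => /eqmx_rowP[c _ ->] Ax.
by rewrite linearZ -!scalemxAl /= -scalemxAr Ax !scaler0.
Qed.

Lemma tangent_at_eqmx A x x' l l' : (x == x')%MS -> (l == l')%MS ->
  tangent_at A x l -> tangent_at A x' l'.
Proof.
move=> xx ll [Ax lx]; split; first exact: on_conic_eqmx xx Ax.
rewrite eqmxb_sym in ll; apply: eqmxb_trans ll (eqmxb_trans lx _).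
exact/eqmxP/eqmxMr/eqmxP.
Qed.

Lemma tangent_eqmx A l l' : (l == l')%MS -> tangent A l -> tangent A l'.
Proof.
move=> ll [x nx tan]; exists x => //.
exact: tangent_at_eqmx (eqmxb_refl x) ll tan.
Qed.

Lemma poncelet_triangle_eqmx K A (v v' l l' : 'I_3 -> 'rV[C]_3) :
  (forall i, (v i == v' i)%MS) -> (forall i, (l i == l' i)%MS) ->
  poncelet_triangle K A v l -> poncelet_triangle K A v' l'.
Proof.
move=> vv ll tri i; have [nv nl] := tri i.
have eqmx_congr (x x' y y' : 'rV[C]_3) : (x == x')%MS -> (y == y')%MS ->
    (x' == y')%MS -> (x == y)%MS.
  by move=> ex ey exy; apply: eqmxb_trans ex (eqmxb_trans exy _); rewrite eqmxb_sym.
move=> [[Kv lv] [Kw lw] tanK] [[Al lAl] [Am mAm] tanA].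
rewrite (eqmx_eq0 (eqmxP (vv i))) in nv; rewrite (eqmx_eq0 (eqmxP (ll i))) in nl.
split=> //.
  split; [split | split |].
  - exact: on_conic_eqmx Kv.
  - exact: on_line_eqmx lv.
  - exact: on_conic_eqmx Kw.
  - exact: on_line_eqmx lw.
  - by move=> /(eqmx_congr _ _ _ _ (vv i) (vv (ordS i)))/tanK; apply: tangent_at_eqmx.
split; [split | split |].
- exact: tangent_eqmx Al.
- exact: on_line_eqmx lAl.
- exact: tangent_eqmx Am.
- exact: on_line_eqmx mAm.
- by move=> /(eqmx_congr _ _ _ _ (ll i) (ll (ordS i)))/tanA; apply: tangent_at_eqmx.
Qed.

Section DualConic.
Variables (A D : 'M[C]_3) (m : C).
Hypotheses (nm : m != 0) (sA : A^T = A) (sD : D^T = D) (AD : A *m D = m%:M).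

Lemma tangent_at_dual x l : tangent_at A x l -> (l *m D == x)%MS.
Proof.
case=> _ /eqmxP lx; apply/eqmxP; apply: eqmx_trans (eqmxMr D lx) _.
by rewrite -mulmxA AD mul_mx_scalar; exact: eqmx_scale.
Qed.

Lemma tangent_dual l : l != 0 -> tangent A l <-> l *m D *m l^T = 0.
Proof.
move=> nl; split.
  case=> x _ [Ax /eqmx_rowP[c _ ->]].
  rewrite linearZ -!scalemxAl /= -scalemxAr trmx_mul sA -(mulmxA x) AD.
  by rewrite mul_mx_scalar -scalemxAl mulmxA [x *m A *m _]Ax !scaler0.
move=> lDl0; have lDA : l *m D *m A = m *: l.
  by rewrite -mulmxA -[D *m A]trmxK trmx_mul sD sA AD tr_scalar_mx mul_mx_scalar.
exists (l *m D).
  apply: contraNneq nl => lD0; move: lDA; rewrite lD0 mul0mx => /esym/eqP.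
  by rewrite scaler_eq0 (negPf nm).
split; last by rewrite lDA; exact/eqmxP/eqmx_sym/eqmx_scale.
by rewrite /on_conic lDA trmx_mul sD -scalemxAl mulmxA lDl0 scaler0.
Qed.

End DualConic.
End Incidence.

(** * The complexified unit circle *)

Section CircleParametrization.
Context {R : realType}.
Local Notation C := R[i].
Local Notation K := (complexify (unit_circle_mx R)).
Implicit Types (p q k : C) (z w : C * C) (l v : 'rV[C]_3).

Let two_neq0 : 2 != 0 :> C. Proof. by rewrite pnatr_eq0. Qed.

(* In the coordinates X = x + i y, Y = x - i y the circle is X Y = T^2, with
   points (s^2 : r^2 : s r). *)
Definition circle_point z : 'rV[C]_3 :=
  row3 (z.1 ^+ 2 + z.2 ^+ 2) (- 'i * (z.1 ^+ 2 - z.2 ^+ 2)) (2 * (z.1 * z.2)).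

Definition chord z w : 'rV[C]_3 :=
  row3 (z.2 * w.2 + z.1 * w.1) ('i * (z.2 * w.2 - z.1 * w.1))
    (- (z.1 * w.2 + w.1 * z.2)).

Lemma chordC z w : chord z w = chord w z.
Proof. by rewrite /chord; congr row3; ring. Qed.

Lemma complexify_unit_circle : K = sym3 1 0 0 1 0 (-1).
Proof.
rewrite /complexify /unit_circle_mx.
apply/matrixP; case; case=> [|[|[|//]]] lti; case; case=> [|[|[|//]]] ltj;
  by rewrite !mxE /= ?mulr1n ?mulr0n ?rmorph0 ?rmorph1 ?rmorphN1.
Qed.

Lemma chord_circle_point z w u :
  chord z w *m (circle_point u)^T = (2 * (wedge z u * wedge w u))%:M.
Proof. by rewrite mul_row3_tr /wedge; congr _%:M; ring: (@sqrCi C). Qed.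

Lemma circle_point_polar z : circle_point z *m K = chord z z.
Proof. by rewrite complexify_unit_circle mul_row3_sym3; congr row3; ring. Qed.

Lemma circle_point_scale c z :
  circle_point (c * z.1, c * z.2) = c ^+ 2 *: circle_point z.
Proof. by rewrite scale_row3; congr row3 => /=; ring. Qed.

Lemma chord_scale c d z w :
  chord (c * z.1, c * z.2) (d * w.1, d * w.2) = (c * d) *: chord z w.
Proof. by rewrite scale_row3; congr row3 => /=; ring. Qed.

Lemma chord_neq0 z w : z != 0 -> w != 0 -> chord z w != 0.
Proof.
move=> nz nw; have [u zu wu] := wedge_neq0_exists nz nw.
apply: contraTneq (mulf_neq0 zu wu) => zw0.
rewrite negbK -(mulrI_eq0 _ (mulfI two_neq0)).
by apply/eqP/scalar_mx11_eq0; rewrite -chord_circle_point zw0 mul0mx.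
Qed.

Lemma circle_pointP v : v != 0 -> on_conic K v ->
  exists2 z, z != 0 & (v == circle_point z)%MS.
Proof.
have [x [y [t ->]]] := row3P v => nv.
rewrite /on_conic complexify_unit_circle mul_row3_sym3 mul_row3_tr.
move=> /scalar_mx11_eq0 on_K.
pose X := x + 'i * y; pose Y := x - 'i * y.
have XY : X * Y = t ^+ 2.
  by rewrite -[RHS]addr0 -on_K /X /Y; ring: (@sqrCi C).
have vE : row3 x y t = 2^-1 *: row3 (X + Y) (- 'i * (X - Y)) (2 * t).
  by rewrite scale_row3 /X /Y; congr row3; field: (@sqrCi C).
rewrite vE; have [Y0|nY] := eqVneq Y 0.
  exists (1, 0); first by rewrite xpair_eqE oner_eq0.
  have t0 : t = 0 by move/eqP: XY; rewrite Y0 mulr0 eq_sym expf_eq0 => /eqP.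
  have nX : X != 0.
    apply: contraNneq nv => X0.
    by rewrite vE X0 Y0 t0 addr0 subr0 !mulr0 row3_0 scaler0.
  apply/eqmx_rowP; exists (2^-1 * X); first by rewrite mulf_neq0 ?invr_neq0.
  by rewrite /circle_point Y0 t0 !scale_row3 /=; congr row3; ring.
exists (t, Y); first by rewrite xpair_eqE negb_and nY orbT.
apply/eqmx_rowP; exists ((2 * Y)^-1); first by rewrite invr_neq0 ?mulf_neq0.
rewrite /circle_point /= -XY !scale_row3; congr row3; by field.
Qed.

Lemma circle_point_neq0 z : z != 0 -> circle_point z != 0.
Proof.
move=> nz; apply: contraNneq (chord_neq0 nz nz) => z0.
by rewrite -circle_point_polar z0 mul0mx.
Qed.

Lemma circle_point_eqmx z w : z != 0 -> w != 0 ->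
  (circle_point z == circle_point w)%MS <-> wedge z w = 0.
Proof.
move=> nz nw; split=> [/eqmx_rowP[c nc e]|/(wedge_eq0P nz nw)[c nc ->]].
  have := chord_circle_point w w z.
  rewrite e linearZ /= -scalemxAr chord_circle_point wedgexx !mulr0 raddf0.
  rewrite scaler0 => /esym/scalar_mx11_eq0/eqP.
  by rewrite (mulrI_eq0 _ (mulfI two_neq0)) mulf_eq0 orbb wedgeN oppr_eq0 => /eqP.
by rewrite circle_point_scale; apply/eqmxP/eqmx_sym/eqmx_scale; rewrite expf_neq0.
Qed.

Lemma on_line_chordP z w u :
  on_line (chord z w) (circle_point u) <-> wedge z u * wedge w u = 0.
Proof.
rewrite /on_line -[_ *m _]trmxK trmx_mul trmxK chord_circle_point tr_scalar_mx.
apply: iff_trans (scalar_mx11_eq0 _) _; split=> [/eqP|->]; last exact: mulr0.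
by rewrite (mulrI_eq0 _ (mulfI two_neq0)) => /eqP.
Qed.

Lemma on_line_chordl z w : on_line (chord z w) (circle_point z).
Proof. by apply/on_line_chordP; rewrite wedgexx mul0r. Qed.

Lemma on_line_chordr z w : on_line (chord z w) (circle_point w).
Proof. by rewrite chordC; exact: on_line_chordl. Qed.

Lemma circle_point_on_circle z : on_conic K (circle_point z).
Proof.
by rewrite /on_conic circle_point_polar chord_circle_point wedgexx mul0r mulr0 raddf0.
Qed.

Lemma chord_eqmx z z' w w' : z != 0 -> z' != 0 -> w != 0 -> w' != 0 ->
  wedge z z' = 0 -> wedge w w' = 0 -> (chord z w == chord z' w')%MS.
Proof.
move=> nz nz' nw nw' /(wedge_eq0P nz nz')[c nc ->] /(wedge_eq0P nw nw')[d nd ->].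
by rewrite chord_scale; apply/eqmxP/eqmx_sym/eqmx_scale; rewrite mulf_neq0.
Qed.

Lemma intersections_chord z w l : z != 0 -> w != 0 -> l != 0 ->
  intersections K l (circle_point z) (circle_point w) -> (l == chord z w)%MS.
Proof.
move=> nz nw nl [[_ lz] [_ lw] tan].
have [zw|nzw] := eqVneq (wedge z w) 0.
  have /tan[_] : (circle_point z == circle_point w)%MS by exact/circle_point_eqmx.
  rewrite circle_point_polar => lzz; apply: eqmxb_trans lzz _.
  by apply: chord_eqmx; rewrite ?wedgexx.
have nzw_points : ~~ (circle_point z == circle_point w)%MS.
  by apply: contra nzw => /circle_point_eqmx ->.
exact: (projective_line_unique (circle_point_neq0 nz) (circle_point_neq0 nw)
  nzw_points nl (chord_neq0 nz nw) lz lw (on_line_chordl z w) (on_line_chordr z w)).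
Qed.

(* The dual form l |-> 4 l(p) l(q) - k (l_1^2 + l_2^2). *)
Definition focal_dual p q k : 'M[C]_3 :=
  2 *: ((plane_point p)^T *m plane_point q + (plane_point q)^T *m plane_point p)
  - k *: sym3 1 0 0 1 0 0.

Lemma tr_focal_dual p q k : (focal_dual p q k)^T = focal_dual p q k.
Proof.
rewrite linearB !linearZ linearD /= !trmx_mul !trmxK tr_sym3.
by rewrite scalerN [X in 2 *: X + _]addrC.
Qed.

Lemma plane_pointE p : plane_point p = row3 ('Re p) ('Im p) 1.
Proof. by rewrite /plane_point complexRe complexIm. Qed.

Lemma chord_plane_point p z w :
  chord z w *m (plane_point p)^T = (chord_value p p^* z w)%:M.
Proof.
rewrite plane_pointE mul_row3_tr /chord_value; congr _%:M.
have conj_p : p^* = 'Re p - 'i * 'Im p.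
  by rewrite {1}[p]Crect conjC_rect ?Creal_Re ?Creal_Im.
transitivity (('Re p + 'i * 'Im p) * (z.2 * w.2)
    + ('Re p - 'i * 'Im p) * (z.1 * w.1) - (z.1 * w.2 + w.1 * z.2)).
  by ring.
by rewrite -Crect -conj_p.
Qed.

Lemma chord_focal_dual p q k z w1 w2 :
  chord z w1 *m focal_dual p q k *m (chord z w2)^T =
  (2 * tangency_polar p p^* q q^* k z w1 w2)%:M.
Proof.
have tr u x : plane_point u *m (chord z x)^T = (chord_value u u^* z x)%:M.
  by rewrite -[LHS]trmxK trmx_mul trmxK chord_plane_point tr_scalar_mx.
rewrite mulmxBr mulmxBl -!scalemxAr -!scalemxAl mulmxDr mulmxDl !mulmxA.
rewrite !chord_plane_point -!mulmxA !tr -!scalar_mxM.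
rewrite mulmxA mul_row3_sym3 mul_row3_tr.
apply/matrixP => i j; rewrite !ord1 !mxE eqxx !mulr1n /tangency_polar.
by ring: (@sqrCi C).
Qed.

End CircleParametrization.

Lemma ordS_iter3 (i : 'I_3) : ordS (ordS (ordS i)) = i.
Proof. by apply/val_inj; case: i => -[|[|[|//]]]. Qed.

Section PonceletTriangles.
Context {R : realType}.
Local Notation C := R[i].
Local Notation K := (complexify (unit_circle_mx R)).
Variables (A : 'M[C]_3) (m p q k : C).
Hypotheses (nm : m != 0) (sA : A^T = A) (AD : A *m focal_dual p q k = m%:M).
Local Notation tangency := (tangency p p^* q q^* k).
Local Notation neighbours := (neighbours p p^* q q^* k).
Implicit Types (z w : C * C).

Let two_neq0 : 2 != 0 :> C. Proof. by rewrite pnatr_eq0. Qed.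

Lemma tangent_chord z w : z != 0 -> w != 0 ->
  tangent A (chord z w) <-> tangency z w = 0.
Proof.
move=> nz nw; apply: iff_trans (tangent_dual nm sA (tr_focal_dual p q k) AD
  (chord_neq0 nz nw)) _.
rewrite chord_focal_dual tangency_polarxx; split=> [/scalar_mx11_eq0/eqP|->].
  by rewrite !(mulrI_eq0 _ (mulfI two_neq0)) => /eqP.
by rewrite !mulr0 raddf0.
Qed.

Lemma tangents_from_neighbours z w1 w2 : z != 0 -> w1 != 0 -> w2 != 0 ->
  tangents_from A (circle_point z) (chord w1 z) (chord z w2) -> neighbours z w1 w2.
Proof.
rewrite chordC => nz nw1 nw2 [[tan1 _] [tan2 _] tan].
have [w12|nw12] := eqVneq (wedge w1 w2) 0; last first.
  by apply: neighbours_distinct => //; apply/tangent_chord.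
have /tan/(tangent_at_dual nm AD)/eqmx_rowP[c _ dual] : (chord z w1 == chord z w2)%MS.
  by apply: chord_eqmx; rewrite ?wedgexx.
apply: neighbours_double => // w; apply: (mulfI two_neq0); rewrite mulr0.
apply/scalar_mx11_eq0; rewrite -chord_focal_dual -mulmxA -[_ *m (chord z w1)^T]trmxK.
rewrite trmx_mul trmxK tr_focal_dual dual linearZ /= -scalemxAr chord_circle_point.
by rewrite wedgexx mul0r mulr0 raddf0 scaler0.
Qed.

Lemma poncelet_triangle_parametrization (v l : 'I_3 -> 'rV[C]_3) :
  poncelet_triangle K A v l -> exists z : 'I_3 -> C * C,
  [/\ forall i, z i != 0, forall i, (v i == circle_point (z i))%MS &
      forall i, (l i == chord (z i) (z (ordS i)))%MS].
Proof.
move=> tri.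
have /choice[z vz] i : exists z, z != 0 /\ (v i == circle_point z)%MS.
  have [nv _ [[Kv _] _ _] _] := tri i.
  by have [z nz vz] := circle_pointP nv Kv; exists z.
exists z; split=> i; [by have [] := vz i | by have [] := vz i |].
have := poncelet_triangle_eqmx (fun j => (vz j).2) (fun j => eqmxb_refl (l j)) tri.
move=> /(_ i)[_ nl int _].
apply: intersections_chord nl int; [by have [] := vz i | by have [] := vz (ordS i)].
Qed.

Lemma poncelet_triangle_focal_constant (v l : 'I_3 -> 'rV[C]_3) :
  poncelet_triangle K A v l -> ~ trivial_polygon K A v l ->
  k = focal_constant p p^* q q^*.
Proof.
move=> tri; have [z [nz vz lz]] := poncelet_triangle_parametrization tri.
have {}tri := poncelet_triangle_eqmx vz lz tri.
move=> ntriv; apply/eqP; apply: contra_notT ntriv => nk.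
have nb i : neighbours (z (ordS i)) (z i) (z (ordS (ordS i))).
  by have [_ _ _ tan] := tri i; exact: tangents_from_neighbours tan.
have wedgeS i : wedge (z i) (z (ordS i)) = 0.
  apply: (neighbours_wedge_eq0 (z3 := z (ordS (ordS i))) nk) => //.
    by have := nb (ordS (ordS i)); rewrite ordS_iter3; exact: neighboursC.
  exact/neighboursC/nb.
have wedge0 i : wedge (z i) (z 0) = 0.
  have : [\/ i = 0, i = ordS 0 | i = ordS (ordS 0)].
    by case: i => -[|[|[|//]]] lt3;
      [constructor 1 | constructor 2 | constructor 3]; apply/val_inj.
  case=> ->; first exact: wedgexx.
    by rewrite wedgeN wedgeS oppr0.
  by rewrite -{2}(ordS_iter3 0) wedgeS.
have v0 i : (v i == circle_point (z 0))%MS.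
  by apply: eqmxb_trans (vz i) _; exact/circle_point_eqmx.
have l0 i : (l i == chord (z 0) (z 0))%MS.
  by apply: eqmxb_trans (lz i) _; exact: chord_eqmx.
exists (circle_point (z 0)), (chord (z 0) (z 0)); split=> //.
  by split; [exact: circle_point_on_circle | rewrite circle_point_polar eqmxb_refl].
have [_ _ _ [_ _]] := tri 0.
have l01 : (chord (z 0) (z (ordS 0)) == chord (z (ordS 0)) (z (ordS (ordS 0))))%MS.
  by apply: chord_eqmx.
move=> /(_ l01); apply: tangent_at_eqmx; first exact/circle_point_eqmx.
by apply: chord_eqmx => //; exact: wedgexx.
Qed.

Lemma poncelet_triangle_of_tangencies (z : 'I_3 -> C * C) : (forall i, z i != 0) ->
  (forall i, wedge (z i) (z (ordS i)) != 0) ->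
  (forall i, tangency (z i) (z (ordS i)) = 0) ->
  exists v l, poncelet_triangle K A v l /\ ~ trivial_polygon K A v l.
Proof.
move=> nz nwedge tan; pose v i := circle_point (z i).
pose l i := chord (z i) (z (ordS i)).
have nv i : ~~ (v i == v (ordS i))%MS.
  by apply: contra (nwedge i) => /circle_point_eqmx ->.
have nl i : ~~ (l i == l (ordS i))%MS.
  pose j := ordS (ordS i).
  have ij : wedge (z j) (z i) != 0.
    by have := nwedge j; rewrite /j ordS_iter3.
  apply: contraNN (mulf_neq0 ij (nwedge (ordS i))) => lS.
  rewrite eqmxb_sym in lS.
  have /on_line_chordP : on_line (l i) (v j).
    exact: on_line_eqmx (eqmxb_refl _) lS (on_line_chordr _ _).
  by rewrite [wedge (z j) _]wedgeN mulNr => ->; rewrite oppr0.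
have tanA i : tangent A (l i) by exact/tangent_chord.
have v_on_l i : on_line (l i) (v i) by exact: on_line_chordl.
have vS_on_l i : on_line (l i) (v (ordS i)) by exact: on_line_chordr.
have v_on_K i : on_conic K (v i) by exact: circle_point_on_circle.
exists v, l; split=> [i|[x [t [_ _ trivial]]]].
  split; [exact: circle_point_neq0 | exact: chord_neq0 | |]; split=> //.
    by rewrite (negPf (nv i)).
  by rewrite (negPf (nl i)).
have /negP := nv 0; apply.
have [v0 _] := trivial 0; have [v1 _] := trivial (ordS 0).
by apply: eqmxb_trans v0 _; rewrite eqmxb_sym.
Qed.

End PonceletTriangles.

(** * Equations of conics with given foci *)

Section CentralConics.
Context {R : rcfType}.
Implicit Types (alpha beta x y : R) (A : 'M[R]_3).

Lemma central_conic_point alpha beta : 0 < alpha -> exists x y,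
  [/\ 0 < x, 0 < y & alpha * x ^+ 2 + beta * y ^+ 2 = 1].
Proof.
move=> alpha_gt0; pose y := (1 + `|beta|)^-1.
have y_gt0 : 0 < y by rewrite invr_gt0; have := normr_ge0 beta; lra.
have betay : beta * y ^+ 2 < 1.
  have := ler_norm beta; have := normr_ge0 beta; rewrite /y exprVn => ? ?.
  by rewrite ltr_pdivrMr ?exprn_gt0; nra.
exists (Num.sqrt ((1 - beta * y ^+ 2) / alpha)), y; split=> //.
  by rewrite sqrtr_gt0 divr_gt0 ?subr_gt0.
rewrite sqr_sqrtr ?divr_ge0 ?subr_ge0 ?ltW // mulrC divfK ?gt_eqF //.
by rewrite subrK.
Qed.

Lemma sym_mx_vanish_central_conic alpha beta A : 0 < alpha -> A^T = A ->
  (forall x y, alpha * x ^+ 2 + beta * y ^+ 2 = 1 ->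
    row3 x y 1 *m A *m (row3 x y 1)^T = 0) ->
  exists r, A = r *: sym3 alpha 0 0 beta 0 (-1).
Proof.
move=> alpha_gt0 /sym3P[a [b [c [d [e [f ->]]]]]] vanish.
have quad0 x y : alpha * x ^+ 2 + beta * y ^+ 2 = 1 ->
    a * x ^+ 2 + 2 * b * (x * y) + d * y ^+ 2 + 2 * c * x + 2 * e * y + f = 0.
  by move/vanish; rewrite mul_row3_sym3 mul_row3_tr => /scalar_mx11_eq0 <-; ring.
have [x [y [x_gt0 y_gt0 on_xy]]] := central_conic_point beta alpha_gt0.
pose v := Num.sqrt alpha^-1.
have on_v : alpha * v ^+ 2 = 1 by rewrite sqr_sqrtr ?invr_ge0 ?ltW // divff ?gt_eqF.
have := ((quad0 x y, quad0 (- x) y, quad0 x (- y), quad0 (- x) (- y)),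
  (quad0 v 0, quad0 (- v) 0)).
rewrite !sqrrN !expr0n /= !mulr0 !addr0 on_xy on_v.
move=> [[[[/(_ erefl) at_xy /(_ erefl) at_Nxy] /(_ erefl) at_xNy]]].
move=> /(_ erefl) at_NxNy [/(_ erefl) at_v /(_ erefl) at_Nv].
have cancel (r s : R) : 0 < r -> r * s = 0 -> s = 0.
  by move=> r0 /eqP; rewrite mulrI_eq0 => [/eqP //|]; apply/mulfI; rewrite gt_eqF.
have b0 : b = 0 by apply: (cancel (x * y)); rewrite ?mulr_gt0 //; lra.
have c0 : c = 0 by apply: (cancel x) => //; lra.
have e0 : e = 0 by apply: (cancel y) => //; lra.
have aE : a = - f * alpha.
  have av : a * v ^+ 2 = - f by lra.
  by rewrite -av -mulrA [v ^+ 2 * _]mulrC on_v mulr1.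
have dE : d = - f * beta.
  apply/eqP; rewrite -subr_eq0; apply/eqP/(cancel (y ^+ 2)).
    by rewrite exprn_gt0.
  have : a * x ^+ 2 = - f * (1 - beta * y ^+ 2) by rewrite aE -on_xy; ring.
  by lra.
by exists (- f); rewrite scale_sym3 b0 c0 e0 aE dE; congr sym3; ring.
Qed.

End CentralConics.

Section FocalConics.
Context {R : realType}.
Local Notation C := R[i].
Implicit Types (p q u w z : C) (A : 'M[R]_3).

Definition focal_form p q t w : C :=
  (`|w - p| ^+ 2 - `|w - q| ^+ 2) ^+ 2
  - 2 * t * (`|w - p| ^+ 2 + `|w - q| ^+ 2) + t ^+ 2.

(* The rationalisation of |w - p| +- |w - q| = +- sqrt t covers ellipses and
   hyperbolas at once. *)
Definition focal_conic p q t : set C := [set w | focal_form p q t w = 0].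

Lemma focal_form_factor p q d w : focal_form p q (d ^+ 2) w =
  (d ^+ 2 - (`|w - p| + `|w - q|) ^+ 2) * (d ^+ 2 - `| `|w - p| - `|w - q| | ^+ 2).
Proof.
have real_dist : `|w - p| - `|w - q| \is Num.real by rewrite rpredB ?normr_real.
by rewrite (real_normK real_dist) /focal_form; ring.
Qed.

Lemma focal_conic_factorP p q d w : 0 <= d -> focal_conic p q (d ^+ 2) w <->
  `|w - p| + `|w - q| = d \/ `| `|w - p| - `|w - q| | = d.
Proof.
move=> d0; rewrite /focal_conic /= focal_form_factor; split=> [/eqP|[->|->]].
- rewrite mulf_eq0 !subr_eq0 !eqrXn2 ?addr_ge0 //.
  by case/orP=> /eqP ->; [left | right].
- by rewrite subrr mul0r.
- by rewrite subrr mulr0.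
Qed.

Lemma ellipse_focal_conic p q d : `|p - q| < d ->
  ellipse p q d = focal_conic p q (d ^+ 2).
Proof.
move=> pqd; have d0 : 0 <= d by apply: ltW; exact: le_lt_trans pqd.
rewrite predeqE => w; apply: iff_trans (iff_sym (focal_conic_factorP _ _ _ d0)).
split=> [|[//|dE]]; first by left.
have := ler_dist_dist (w - p) (w - q); rewrite dE.
have -> : w - p - (w - q) = q - p by ring.
by rewrite distrC => /(lt_le_trans pqd); rewrite ltxx.
Qed.

Lemma hyperbola_focal_conic p q d : 0 < d < `|p - q| ->
  hyperbola p q d = focal_conic p q (d ^+ 2).
Proof.
move=> /andP[/ltW d0 pqd].
rewrite predeqE => w; apply: iff_trans (iff_sym (focal_conic_factorP _ _ _ d0)).
split=> [|[dE|//]]; first by right.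
have := ler_distD w p q; rewrite [`|p - w|]distrC dE.
by move=> /(lt_le_trans pqd); rewrite ltxx.
Qed.

Lemma conic_with_foci_focal_conic p q S : conic_with_foci p q S ->
  exists t : R, [/\ 0 < t, t%:C%C != `|p - q| ^+ 2 & S = focal_conic p q t%:C%C].
Proof.
have realP d : 0 < d -> exists2 r : R, 0 < r & d = r%:C%C.
  move=> d0; have /complex_realP[r dr] := gtr0_real d0.
  by exists r => //; move: d0; rewrite dr ltcE eqxx.
case=> -[d].
  move=> pqd ->; have [r r0 dr] := realP d (le_lt_trans (normr_ge0 _) pqd).
  exists (r ^+ 2); rewrite rmorphXn /= -dr exprn_gt0 //; split=> //.
    by rewrite gt_eqF // ltrXn2r // ltW // (le_lt_trans _ pqd).
  exact: ellipse_focal_conic.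
move=> /andP[d0 pqd] ->; have [r r0 dr] := realP d d0.
exists (r ^+ 2); rewrite rmorphXn /= -dr exprn_gt0 //; split=> //.
  by rewrite lt_eqF // ltrXn2r // ltW.
by apply: hyperbola_focal_conic; rewrite d0.
Qed.

Definition real_point w : 'rV[R]_3 := row3 (complex.Re w) (complex.Im w) 1.

Lemma plane_point_complexify w :
  plane_point w = map_mx (real_complex R) (real_point w).
Proof. by apply/rowP; case; case=> [|[|[|//]]] lt3; rewrite !mxE. Qed.

Lemma on_conic_complexify A w : on_conic (complexify A) (plane_point w) <->
  real_point w *m A *m (real_point w)^T = 0.
Proof.
rewrite /on_conic plane_point_complexify map_trmx -!map_mxM.
by split=> [/eqP|->]; [rewrite map_mx_eq0 => /eqP | rewrite raddf0].
Qed.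

Definition focal_mx p q (t : R) : 'M[R]_3 :=
  let n1 := - 2 * complex.Re (p - q) in
  let n2 := - 2 * complex.Im (p - q) in
  let np := complex.Re p ^+ 2 + complex.Im p ^+ 2 in
  let nq := complex.Re q ^+ 2 + complex.Im q ^+ 2 in
  sym3 (n1 ^+ 2 - 4 * t) (n1 * n2) (n1 * (np - nq) + 2 * t * complex.Re (p + q))
    (n2 ^+ 2 - 4 * t) (n2 * (np - nq) + 2 * t * complex.Im (p + q))
    ((np - nq) ^+ 2 - 2 * t * (np + nq) + t ^+ 2).

Lemma focal_mx_form p q t w : exists2 x : R, x%:C%C = focal_form p q t%:C%C w &
  real_point w *m focal_mx p q t *m (real_point w)^T = x%:M.
Proof.
rewrite mul_row3_sym3 mul_row3_tr; eexists; last by [].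
rewrite /focal_form -!add_Re2_Im2; case: p q w => [p1 p2] [q1 q2] [w1 w2] /=; ring.
Qed.

Lemma focal_mx_dual p q t :
  complexify (focal_mx p q t) *m focal_dual p q (t%:C%C - `|p - q| ^+ 2) =
  (4 * t%:C%C * (t%:C%C - `|p - q| ^+ 2))%:M.
Proof.
rewrite -add_Re2_Im2 /focal_dual !plane_point_complexify.
case: p q => [p1 p2] [q1 q2] /=.
apply/matrixP; case; case=> [|[|[|//]]] lti; case; case=> [|[|[|//]]] ltj;
  do ?rewrite !mxE ?big_ord_recl ?big_ord0 /=; rewrite ?mulr1n ?mulr0n; ring.
Qed.

Lemma focal_mx_dual_neq0 p q t : 0 < t -> t%:C%C != `|p - q| ^+ 2 ->
  4 * t%:C%C * (t%:C%C - `|p - q| ^+ 2) != 0.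
Proof.
by move=> t_gt0 t_neq; rewrite !mulf_neq0 ?pnatr_eq0 ?subr_eq0 // fmorph_eq0 gt_eqF.
Qed.

Lemma focal_conic_equation p q t : 0 < t -> t%:C%C != `|p - q| ^+ 2 ->
  conic_equation (focal_mx p q t) (focal_conic p q t%:C%C).
Proof.
move=> t_gt0 t_neq; split; first exact: tr_sym3.
  rewrite -(fmorph_eq0 (real_complex R)) /= -det_map_mx.
  apply: contra_neq (expf_neq0 3 (focal_mx_dual_neq0 t_gt0 t_neq)) => detF0.
  by rewrite -det_scalar -focal_mx_dual det_mulmx detF0 mul0r.
rewrite predeqE => w; rewrite /= on_conic_complexify.
have [x fx ->] := focal_mx_form p q t w; rewrite /focal_conic /= -fx.
by rewrite scalar_mx11_eq0; split=> [/complexI|->].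
Qed.

Lemma focal_form_isometry m u p q t w : `|u| = 1 ->
  focal_form (m + u * p) (m + u * q) t (m + u * w) = focal_form p q t w.
Proof.
move=> norm_u; have isometry z : `|m + u * w - (m + u * z)| = `|w - z|.
  by rewrite opprD addrACA subrr add0r -mulrBr normrM norm_u mul1r.
by rewrite /focal_form !isometry.
Qed.

Lemma focal_form_centered (g t x y : R) :
  focal_form g%:C%C (- g%:C%C) t%:C%C (x +i* y)%C =
  (t * (t - 4 * g ^+ 2) - 4 * (t - 4 * g ^+ 2) * x ^+ 2 - 4 * t * y ^+ 2)%:C%C.
Proof. by rewrite /focal_form -!add_Re2_Im2 /=; ring. Qed.

End FocalConics.

Section Frames.
Context {R : realType}.
Local Notation C := R[i].
Implicit Types (p q m u w z : C) (A B : 'M[R]_3).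

Definition frame_mx m u : 'M[R]_3 :=
  \matrix_(i, j) (nth [::] [:: [:: complex.Re u; complex.Im u; 0];
    [:: - complex.Im u; complex.Re u; 0]; [:: complex.Re m; complex.Im m; 1]] i)`_j.

Lemma real_point_frame_mx m u w :
  real_point w *m frame_mx m u = real_point (m + u * w).
Proof.
case: m u w => [m1 m2] [u1 u2] [x y].
by apply/rowP; case; case=> [|[|[|//]]] lt3;
  rewrite !mxE !big_ord_recl big_ord0 !mxE /=; ring.
Qed.

Lemma frame_mx_unit m u : `|u| = 1 -> frame_mx m u \in unitmx.
Proof.
move=> norm_u; suff inv : frame_mx m u *m frame_mx (- (u^* * m)) u^* = 1%:M.
  by have [] := mulmx1_unit inv.
move/(congr1 (fun x => x ^+ 2)): norm_u; rewrite -add_Re2_Im2 /= expr1n => /complexI.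
case: m u => [m1 m2] [u1 u2] /= /(canRL (addrK _)) sqr_u1.
by apply/matrixP; case; case=> [|[|[|//]]] lti; case; case=> [|[|[|//]]] ltj;
  rewrite !mxE !big_ord_recl big_ord0 !mxE /=; ring: sqr_u1.
Qed.

Lemma polar_form z : exists2 u, `|u| = 1 & z = u * `|z|.
Proof.
have [->|nz] := eqVneq z 0; first by exists 1; rewrite ?normr1 // normr0 mulr0.
exists (z / `|z|); last by rewrite divfK ?normr_eq0.
by rewrite normrM normfV normr_id divff ?normr_eq0.
Qed.

Lemma focal_conic_frame p q (t : R) : 0 < t -> t%:C%C != `|p - q| ^+ 2 ->
  exists (m u : C) (alpha beta : R), [/\ `|u| = 1, 0 < alpha &
    forall x y, alpha * x ^+ 2 + beta * y ^+ 2 = 1 ->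
      focal_conic p q t%:C%C (m + u * (x +i* y)%C)].
Proof.
move=> t_gt0; have [u norm_u pq] := polar_form (p - q).
have /complex_realP[g gE] : `|p - q| / 2 \is Num.real.
  by rewrite rpredM ?normr_real // rpredV realn.
have normE : `|p - q| = 2 * g%:C%C by rewrite -gE; field.
rewrite normE => t_neq; pose k := t - 4 * g ^+ 2.
have nk : k != 0.
  by apply: contra_neq t_neq => k0; rewrite -[t](subrK (4 * g ^+ 2)) -/k k0; ring.
pose m := (p + q) / 2.
have pE : p = m + u * g%:C%C.
  by rewrite -gE mulrA -pq /m; field.
have qE : q = m + u * - g%:C%C.
  by rewrite -gE mulrN mulrA -pq /m; field.
exists m, u, (4 / t), (4 / k); split=> //; first by rewrite divr_gt0.
move=> x y xy1; rewrite pE qE /focal_conic /= focal_form_isometry //.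
rewrite focal_form_centered -/k.
have -> : t * k = t * k * (4 / t * x ^+ 2 + 4 / k * y ^+ 2) by rewrite xy1 mulr1.
by rewrite -[RHS](rmorph0 (real_complex R)); congr _%:C%C; field; rewrite nk gt_eqF.
Qed.

Lemma conic_equation_frame p q t m u alpha beta A : 0 < alpha ->
  (forall x y, alpha * x ^+ 2 + beta * y ^+ 2 = 1 ->
      focal_conic p q t (m + u * (x +i* y)%C)) ->
  conic_equation A (focal_conic p q t) ->
  exists r, frame_mx m u *m A *m (frame_mx m u)^T = r *: sym3 alpha 0 0 beta 0 (-1).
Proof.
move=> alpha_gt0 on_focal [sA _ AE]; apply: sym_mx_vanish_central_conic => //.
  by rewrite !trmx_mul trmxK sA mulmxA.
move=> x y /on_focal; rewrite AE /= on_conic_complexify -real_point_frame_mx.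
by rewrite trmx_mul !mulmxA.
Qed.

Lemma focal_conic_equation_unique p q (t : R) A B :
  0 < t -> t%:C%C != `|p - q| ^+ 2 ->
  conic_equation A (focal_conic p q t%:C%C) ->
  conic_equation B (focal_conic p q t%:C%C) ->
  exists2 r, r != 0 & A = r *: B.
Proof.
move=> t_gt0 t_neq eqA eqB.
have [m [u [alpha [beta frame]]]] := focal_conic_frame t_gt0 t_neq.
have [norm_u alpha_gt0 on_focal] := frame.
have [a aE] := conic_equation_frame alpha_gt0 on_focal eqA.
have [b bE] := conic_equation_frame alpha_gt0 on_focal eqB.
have := frame_mx_unit m norm_u.
move: (frame_mx m u) aE bE => M aE bE M_unit.
have neq0 (D : 'M[R]_3) (d : R) : \det D != 0 ->
    M *m D *m M^T = d *: sym3 alpha 0 0 beta 0 (-1) -> d != 0.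
  move=> detD dE; apply: contra_neq detD => d0; rewrite d0 scale0r in dE.
  have : \det (M *m D *m M^T) = 0 by rewrite dE det0.
  move=> /eqP; rewrite !det_mulmx det_tr !mulf_eq0.
  by rewrite (negPf (_ : \det M != 0)) ?orbF /= -?unitfE // => /eqP.
have [na nb] : a != 0 /\ b != 0.
  by case: eqA eqB => [_ detA _] [_ detB _]; split; [exact: neq0 aE | exact: neq0 bE].
exists (a / b); first by rewrite mulf_neq0 ?invr_eq0.
have MT_unit : M^T \in unitmx by rewrite unitmx_tr.
apply: (can_inj (mulKmx M_unit)); apply: (can_inj (mulmxK MT_unit)).
by rewrite -scalemxAr -scalemxAl bE aE scalerA divfK.
Qed.

End Frames.

(** * Blaschke products *)

Section BlaschkeFibers.
Context {C : numClosedFieldType}.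
Implicit Types (p q L z : C).

Lemma blaschke_factor_norm p z :
  `|1 - p^* * z| ^+ 2 - `|p - z| ^+ 2 = (1 - `|p| ^+ 2) * (1 - `|z| ^+ 2).
Proof. by rewrite !normCK !rmorphB !rmorphM rmorph1 /= conjCK; ring. Qed.

Lemma blaschke_factor_lt p z : `|p| < 1 ->
  (`|p - z| < `|1 - p^* * z|) = (`|z| < 1).
Proof.
move=> p_lt1; rewrite -[LHS](ltr_pXn2r (ltn0Sn 1)) ?nnegrE // -[LHS]subr_gt0.
by rewrite blaschke_factor_norm pmulr_rgt0 subr_gt0 expr_lt1.
Qed.

Lemma blaschke_factor_gt p z : `|p| < 1 ->
  (`|1 - p^* * z| < `|p - z|) = (1 < `|z|).
Proof.
move=> p_lt1; rewrite -[LHS](ltr_pXn2r (ltn0Sn 1)) ?nnegrE // -[LHS]subr_lt0.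
by rewrite blaschke_factor_norm pmulr_rlt0 ?subr_gt0 ?subr_lt0 ?expr_lt1 // expr_gt1.
Qed.

Lemma focal_constant_norm p q :
  focal_constant p p^* q q^* = `|1 - p^* * q| ^+ 2 - `|p - q| ^+ 2.
Proof. by rewrite blaschke_factor_norm /focal_constant !normCK. Qed.

Lemma blaschke_fiber_norm p q L z : `|p| < 1 -> `|q| < 1 -> `|L| = 1 ->
  in_blaschke_fiber p p^* q q^* L (z, 1) -> `|z| = 1.
Proof.
move=> p_lt1 q_lt1 norm_L; rewrite /in_blaschke_fiber => /(congr1 Num.norm).
rewrite /blaschke_num /blaschke_den /tangency_const /tangency_lead /= !mulr1 !mul1r.
rewrite !normrM norm_L mul1r => norm_eq.
case: (real_ltgtP (normr_real z) (real1 C)) => // norm_z; exfalso.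
  have : `|p - z| * `|q - z| < `|1 - p^* * z| * `|1 - q^* * z|.
    by rewrite ltr_pM ?blaschke_factor_lt.
  by rewrite -norm_eq => /lt_geF; rewrite ler_piMl ?mulr_ge0 // ltW.
have : `|1 - p^* * z| * `|1 - q^* * z| < `|p - z| * `|q - z|.
  by rewrite ltr_pM ?blaschke_factor_gt.
by rewrite -norm_eq => /lt_geF; rewrite ler_peMl ?mulr_ge0 // ltW.
Qed.

Lemma tangency_diag_neq0 p q z : `|p| < 1 -> `|q| < 1 -> `|z| = 1 ->
  tangency p p^* q q^* (focal_constant p p^* q q^*) (z, 1) (z, 1) != 0.
Proof.
move=> p_lt1 q_lt1 norm_z.
have nz : z != 0 by rewrite -normr_eq0 norm_z oner_eq0.
have bound w : `|w| < 1 -> 0 <= 1 - `|w| ^+ 2 < `|1 - w^* * z| ^+ 2 + (1 - `|w| ^+ 2).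
  move=> w_lt1; apply/andP; split; first by rewrite subr_ge0 expr_le1 // ltW.
  rewrite ltrDr exprn_gt0 // normr_gt0 subr_eq0.
  apply: contraTneq w_lt1 => /(congr1 Num.norm).
  by rewrite normr1 normrM norm_conjC norm_z mulr1 => <-; rewrite ltxx.
have /andP[p_ge0 p_bound] := bound p p_lt1.
have /andP[q_ge0 q_bound] := bound q q_lt1.
have : (1 - `|p| ^+ 2) * (1 - `|q| ^+ 2) < (`|1 - p^* * z| ^+ 2 + (1 - `|p| ^+ 2))
    * (`|1 - q^* * z| ^+ 2 + (1 - `|q| ^+ 2)) by exact: ltr_pM.
rewrite -subr_gt0 => /gt_eqF/negbT; apply: contraNneq => diag0.
apply/eqP; apply: (mulfI (expf_neq0 2 nz)); rewrite mulr0 -diag0.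
rewrite !normCK !rmorphB !rmorphM rmorph1 /= !conjCK.
rewrite /tangency /chord_value /focal_constant /=.
have conj_z : z^* = z^-1 by rewrite invC_norm norm_z expr1n invr1 mul1r.
by rewrite conj_z; field.
Qed.

Definition blaschke_poly p q L : {poly C} :=
  'X * (('X - p%:P) * ('X - q%:P)) - L *: ((1 - p^* *: 'X) * (1 - q^* *: 'X)).

Lemma root_blaschke_polyP p q L z :
  reflect (in_blaschke_fiber p p^* q q^* L (z, 1)) (root (blaschke_poly p q L) z).
Proof.
have -> : root (blaschke_poly p q L) z =
    (blaschke_num p q (z, 1) == L * blaschke_den p^* q^* (z, 1)).
  rewrite rootE -[RHS]subr_eq0; congr (_ == 0); rewrite !hornerE.
  by rewrite /blaschke_num /blaschke_den /tangency_const /tangency_lead /=; ring.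
exact: eqP.
Qed.

Lemma size_blaschke_poly p q L : size (blaschke_poly p q L) = 4.
Proof.
have size_num : size ('X * (('X - p%:P) * ('X - q%:P))) = 4.
  rewrite mulrC size_mulX ?mulf_neq0 ?polyXsubC_eq0 //.
  by rewrite size_mul ?polyXsubC_eq0 // !size_XsubC.
have size_factor c : (size (1 - c *: 'X : {poly C})%R <= 2)%N.
  rewrite (leq_trans (size_polyD _ _)) // size_polyN size_poly1 geq_max /=.
  by rewrite (leq_trans (size_scale_leq _ _)) // size_polyX.
rewrite size_polyDl ?size_num // size_polyN (leq_ltn_trans (size_scale_leq _ _)) //.
apply: leq_ltn_trans (size_polyMleq _ _) _.
have := leq_add (size_factor p^*) (size_factor q^*).
by rewrite -subn1 ltnS leq_subLR => /leq_trans; apply.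
Qed.

(* Being the Bezoutian of the numerator and the denominator of B, the tangency
   form is on the diagonal their Wronskian, which vanishes at double roots. *)
Lemma separable_blaschke_poly p q L : `|p| < 1 -> `|q| < 1 -> `|L| = 1 ->
  separable_poly (blaschke_poly p q L).
Proof.
move=> p_lt1 q_lt1 norm_L; rewrite unlock.
apply: Pdiv.ClosedField.root_coprimep => z /root_blaschke_polyP fiber_z.
have norm_z := blaschke_fiber_norm p_lt1 q_lt1 norm_L fiber_z.
have := tangency_diag_neq0 p_lt1 q_lt1 norm_z.
apply: contra_neq => deriv_z.
transitivity ((blaschke_poly p q L)^`().[z] * blaschke_den p^* q^* (z, 1)
  - (blaschke_num p q (z, 1) - L * blaschke_den p^* q^* (z, 1))
    * ((1 - p^* *: 'X) * (1 - q^* *: 'X))^`().[z]).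
  rewrite !derivE !hornerE /blaschke_num /blaschke_den /tangency_const /tangency_lead.
  by rewrite /tangency /chord_value /focal_constant /=; ring.
by rewrite deriv_z fiber_z subrr !mul0r subrr.
Qed.

Lemma blaschke_fiber_distinct p q L : `|p| < 1 -> `|q| < 1 -> `|L| = 1 ->
  exists2 x : 'I_3 -> C, injective x &
  forall i, in_blaschke_fiber p p^* q q^* L (x i, 1).
Proof.
move=> p_lt1 q_lt1 norm_L.
have [r rE] := closed_field_poly_normal (blaschke_poly p q L).
have lead_neq0 : lead_coef (blaschke_poly p q L) != 0.
  by rewrite lead_coef_eq0 -size_poly_gt0 size_blaschke_poly.
have uniq_r : uniq r.
  rewrite -separable_prod_XsubC -(eqp_separable (eqp_scale _ lead_neq0)) -rE.
  exact: separable_blaschke_poly.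
have size_r : size r = 3.
  have := size_blaschke_poly p q L; rewrite rE size_scale // size_prod_XsubC.
  by case.
exists (fun i => r`_i) => [i j /eqP|i].
  by rewrite nth_uniq ?size_r // => /eqP/val_inj.
apply/root_blaschke_polyP; rewrite rE rootZ // root_prod_XsubC.
by rewrite mem_nth ?size_r.
Qed.

End BlaschkeFibers.

Section PonceletFocalConics.
Context {R : realType}.
Local Notation C := R[i].
Implicit Types (p q z : C) (t : R).

Lemma complexify_focal_mx_dual p q t (r : R) :
  complexify (r *: focal_mx p q t) *m focal_dual p q (t%:C%C - `|p - q| ^+ 2) =
  (r%:C%C * (4 * t%:C%C * (t%:C%C - `|p - q| ^+ 2)))%:M.
Proof.
by rewrite /complexify map_mxZ -scalemxAl [_ *m _]focal_mx_dual scale_scalar_mx.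
Qed.

Lemma tr_complexify (A : 'M[R]_3) : A^T = A -> (complexify A)^T = complexify A.
Proof. by rewrite /complexify map_trmx => ->. Qed.

Lemma poncelet_focal_conic p q t : 0 < t -> t%:C%C != `|p - q| ^+ 2 ->
  poncelet3_inscribed (focal_conic p q t%:C%C) -> t%:C%C = `|1 - p^* * q| ^+ 2.
Proof.
move=> t_gt0 t_neq [A eqA [v [l [tri ntriv]]]].
have eqF := focal_conic_equation t_gt0 t_neq.
have [r nr rA] := focal_conic_equation_unique t_gt0 t_neq eqA eqF.
have AD := complexify_focal_mx_dual p q t r; rewrite -rA in AD.
have sA : (complexify A)^T = complexify A.
  by case: eqA => sA _ _; exact: tr_complexify.
have scale_neq0 : r%:C%C * (4 * t%:C%C * (t%:C%C - `|p - q| ^+ 2)) != 0.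
  by rewrite mulf_neq0 ?fmorph_eq0 // focal_mx_dual_neq0.
have := poncelet_triangle_focal_constant scale_neq0 sA AD tri ntriv.
by rewrite focal_constant_norm => /addIr.
Qed.

Lemma plane_point_circle_point z : `|z| = 1 ->
  (plane_point z == circle_point (z, 1%R))%MS.
Proof.
move=> norm_z.
have conj_z : z^* = z^-1 by rewrite invC_norm norm_z expr1n invr1 mul1r.
have nz : z != 0 by rewrite -normr_eq0 norm_z oner_eq0.
rewrite eqmxb_sym; apply/eqmx_rowP; exists (2 * z).
  by rewrite mulf_neq0 ?pnatr_eq0.
rewrite plane_pointE scale_row3 /circle_point /= ReE ImE conj_z.
by congr row3; field: (@sqrCi C).
Qed.

Lemma blaschke_in_fiber p q L z : `|L| = 1 -> blaschke p q z = L ->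
  in_blaschke_fiber p p^* q q^* L (z, 1).
Proof.
rewrite /blaschke /in_blaschke_fiber /blaschke_num /blaschke_den.
rewrite /tangency_const /tangency_lead /= => norm_L BL.
have nL : L != 0 by rewrite -normr_eq0 norm_L oner_eq0.
(* Division by zero is zero, so that the factors of B(z) <> 0 are invertible. *)
have [np nq] : 1 - p^* * z != 0 /\ 1 - q^* * z != 0.
  by split; apply: contra_neq nL => den0; rewrite -BL den0 invr0 !(mulr0, mul0r).
by rewrite -BL !mulr1; field; rewrite np nq.
Qed.

Section BlaschkeEllipse.
Variables (p q : C) (t : R).
Hypotheses (p_lt1 : `|p| < 1) (q_lt1 : `|q| < 1) (tE : t%:C%C = `|1 - p^* * q| ^+ 2).

Lemma blaschke_axis_nondegenerate : 0 < t /\ t%:C%C != `|p - q| ^+ 2.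
Proof.
have pq : `|p - q| ^+ 2 < t%:C%C.
  by rewrite tE ltrXn2r // blaschke_factor_lt.
split; last by rewrite gt_eqF.
by have := le_lt_trans (exprn_ge0 2 (normr_ge0 _)) pq; rewrite ltcE eqxx.
Qed.

Let t_gt0 : 0 < t. Proof. by case: blaschke_axis_nondegenerate. Qed.

Let t_neq : t%:C%C != `|p - q| ^+ 2. Proof. by case: blaschke_axis_nondegenerate. Qed.

Lemma blaschke_focal_mx_dual :
  complexify (focal_mx p q t) *m focal_dual p q (focal_constant p p^* q q^*) =
  (4 * t%:C%C * (t%:C%C - `|p - q| ^+ 2))%:M.
Proof. by rewrite focal_constant_norm -tE focal_mx_dual. Qed.

Let param_neq0 z : (z, 1) != 0 :> C * C.
Proof. by rewrite xpair_eqE oner_eq0 andbF. Qed.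

Let wedge_param z w : (wedge (z, 1) (w, 1) != 0) = (z != w).
Proof. by rewrite /wedge mulr1 mul1r subr_eq0. Qed.

Lemma focal_conic_poncelet : poncelet3_inscribed (focal_conic p q t%:C%C).
Proof.
have [x x_inj fiber] := blaschke_fiber_distinct p_lt1 q_lt1 (normr1 C).
exists (focal_mx p q t); first exact: focal_conic_equation.
have nw i : wedge (x i, 1) (x (ordS i), 1) != 0.
  by rewrite wedge_param (inj_eq x_inj); case: i => -[|[|[|//]]].
apply: (poncelet_triangle_of_tangencies (focal_mx_dual_neq0 t_gt0 t_neq)
  (tr_complexify (tr_sym3 _ _ _ _ _ _)) blaschke_focal_mx_dual _ nw) => i.
  exact: param_neq0.
exact: tangency_blaschke_fiber (nw i) (fiber i) (fiber (ordS i)).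
Qed.

Lemma blaschke_fiber_tangent L z w l : `|L| = 1 ->
  blaschke p q z = L -> blaschke p q w = L -> z != w -> l != 0 ->
  on_line l (plane_point z) -> on_line l (plane_point w) ->
  tangent (complexify (focal_mx p q t)) l.
Proof.
move=> norm_L /(blaschke_in_fiber norm_L) fiber_z /(blaschke_in_fiber norm_L) fiber_w.
move=> zw nl lz lw.
have pz := plane_point_circle_point (blaschke_fiber_norm p_lt1 q_lt1 norm_L fiber_z).
have pw := plane_point_circle_point (blaschke_fiber_norm p_lt1 q_lt1 norm_L fiber_w).
have nzw : wedge (z, 1) (w, 1) != 0 by rewrite wedge_param.
have chord_l : (chord (z, 1%R) (w, 1%R) == l)%MS.
  rewrite eqmxb_sym; apply: intersections_chord nl _ => //.
  split; [split | split |].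
  - exact: circle_point_on_circle.
  - exact: on_line_eqmx pz (eqmxb_refl l) lz.
  - exact: circle_point_on_circle.
  - exact: on_line_eqmx pw (eqmxb_refl l) lw.
  - by move/circle_point_eqmx => wedge0; rewrite wedge0 ?eqxx in nzw.
apply: tangent_eqmx chord_l _.
apply/(tangent_chord (focal_mx_dual_neq0 t_gt0 t_neq)
  (tr_complexify (tr_sym3 _ _ _ _ _ _)) blaschke_focal_mx_dual
  (param_neq0 z) (param_neq0 w)).
exact: tangency_blaschke_fiber nzw fiber_z fiber_w.
Qed.

End BlaschkeEllipse.
End PonceletFocalConics.

Theorem theorem5p7 (R : realType) (p q : R[i]) (hp : `|p| < 1) (hq : `|q| < 1) :
  (exists! C : set R[i], conic_with_foci p q C /\ poncelet3_inscribed C) /\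
  (forall C : set R[i], conic_with_foci p q C -> poncelet3_inscribed C ->
    [/\ ellipse_with_foci p q C,
        blaschke_ellipse p q C &
        C = [set w : R[i] | `|w - p| + `|w - q| = `|1 - p^* * q|]]).
Proof.
have axis : `|p - q| < `|1 - p^* * q| by rewrite blaschke_factor_lt.
have /complex_realP[t tE] : `|1 - p^* * q| ^+ 2 \is Num.real.
  by rewrite rpredX ?normr_real.
have [t_gt0 t_neq] := blaschke_axis_nondegenerate hp hq (esym tE).
pose E := ellipse p q `|1 - p^* * q|.
have foci_E : ellipse_with_foci p q E by exists `|1 - p^* * q|.
have EE : E = focal_conic p q t%:C%C by rewrite -tE; exact: ellipse_focal_conic.
have poncelet_E : poncelet3_inscribed E.
  by rewrite EE; exact: focal_conic_poncelet.
have unique S : conic_with_foci p q S -> poncelet3_inscribed S -> S = E.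
  move=> /conic_with_foci_focal_conic[s [s_gt0 s_neq ->]].
  move=> /(poncelet_focal_conic s_gt0 s_neq) sE.
  by rewrite EE sE tE.
split=> [|S foci poncelet].
  by exists E; split=> [|S [foci poncelet]]; [split; [left|] | rewrite (unique S)].
rewrite (unique S) //; split=> //; split=> //.
exists (focal_mx p q t); first by rewrite EE; exact: focal_conic_equation.
by move=> L z w norm_L Bz Bw zw l; exact: blaschke_fiber_tangent norm_L Bz Bw zw.
Qed.
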